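(* Let $\delta\in\{+2,-2\}$. Suppose that the finite group $G$ contains a Paley-type $\left(v,\frac{v-1}{2},\frac{v-5}{4},\frac{v-1}{4}\right)$-partial difference set and the finite group $G'$ contains a skew Hadamard $\left(v+\delta,\frac{(v+\delta)-1}{2},\frac{(v+\delta)-3}{4}\right)$-difference set. Then the product group $G\times G'$ contains a Paley-Hadamard difference set in the Stanton-Sprott (twin prime power) family, i.e. with $w=v(v+\delta)$, a $\left(w,\frac{w-1}{2},\frac{w-3}{4}\right)$-difference set.
   Context: A $(v,k,\lambda,\mu)$-partial difference set (PDS) in a finite group $G$ (not necessarily abelian) of order $v$ is a subset $D$ with $|D|=k$ such that every nonidentity element of $D$ can be written as $d_1d_2^{-1}$ with $d_1,d_2\in D$ in exactly $\lambda$ ways, and every nonidentity element of $G-D$ in exactly $\mu$ ways. PDSs are assumed regular: $1_G\notin D$ and $D=D^{-1}$. A $(v,k,\lambda)$-difference set in a group $G$ of order $v$ is a subset $D$ with $|D|=k$ such that every nonidentity element of $G$ can be written as $d_1d_2^{-1}$ with $d_1,d_2\in D$ in exactly $\lambda$ ways. A $(v,\frac{v-1}{2},\frac{v-3}{4})$-difference set is called Paley-Hadamard; such a difference set $D$ in $G$ is skew (skew Hadamard) if $G$ is the disjoint union of $\{1_G\}$, $D$ and $D^{(-1)}=\{d^{-1}:d\in D\}$. *)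

(* Defs.v *)
From mathcomp Require Import all_boot all_order all_algebra all_fingroup.

Set Implicit Arguments.
Unset Strict Implicit.
Unset Printing Implicit Defensive.

Import GRing.Theory.
Local Open Scope ring_scope.

(* A group is the full carrier of a finGroupType; its law is written in
   group_scope.  Parameters are rational numbers, so that expressions such as
   (v - 5) / 4 are exact: no truncated subtraction or division takes place, and
   integrality is forced by equating parameters with cardinals. *)

Definition num_diff (gT : finGroupType) (D : {set gT}) (g : gT) : nat :=
  #|[set p in setX D D | (p.1 * p.2^-1)%g == g]|.

Definition regular_set (gT : finGroupType) (D : {set gT}) : Prop :=
  (1%g \notin D) /\ D = (D^-1)%g.

Definition partial_difference_set (gT : finGroupType) (v k lambda mu : rat)
    (D : {set gT}) : Prop :=
  [/\ #|[set: gT]|%:R = v,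
      #|D|%:R = k,
      forall g : gT, g != 1%g -> g \in D -> (num_diff D g)%:R = lambda,
      forall g : gT, g != 1%g -> g \notin D -> (num_diff D g)%:R = mu
    & regular_set D].

Definition difference_set (gT : finGroupType) (v k lambda : rat)
    (D : {set gT}) : Prop :=
  [/\ #|[set: gT]|%:R = v,
      #|D|%:R = k
    & forall g : gT, g != 1%g -> (num_diff D g)%:R = lambda].

Definition paley_type_pds (gT : finGroupType) (v : rat) (D : {set gT}) : Prop :=
  partial_difference_set v ((v - 1) / 2) ((v - 5) / 4) ((v - 1) / 4) D.

Definition paley_hadamard (gT : finGroupType) (v : rat) (D : {set gT}) : Prop :=
  difference_set v ((v - 1) / 2) ((v - 3) / 4) D.

Definition skew (gT : finGroupType) (D : {set gT}) : Prop :=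
  [/\ [set: gT] = [set 1%g] :|: D :|: (D^-1)%g,
      [disjoint [set 1%g] & D],
      [disjoint [set 1%g] & (D^-1)%g]
    & [disjoint D & (D^-1)%g]].

Definition skew_hadamard (gT : finGroupType) (v : rat) (D : {set gT}) : Prop :=
  paley_hadamard v D /\ skew D.

(* Main.v *)
Require Import Defs.
From mathcomp Require Import all_boot all_order all_algebra all_fingroup.
From mathcomp Require Import ring.

(** Replace a subset by a function: a Paley-type partial difference set in [G]
    or a skew Hadamard difference set in [G'] becomes a function with values 0
    at the identity and 1 or -1 elsewhere (the quadratic character, in the
    classical case), call these [X] and [Y].  The parameters say exactly that
    both sum to 0 and have the autocorrelation of a quadratic character, namely
    the group order minus 1 at the identity and -1 elsewhere
    ([corr_character]).  They differ in parity: [X] is even and [Y] is odd.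

    Write [J] for the constant function 1, [d] for the indicator of the
    identity, and [eps] for delta / 2, which is 1 or -1.  The twin prime power
    construction is the set where the function

      [a = X (x) Y + eps (J (x) d - d (x) J) + d (x) d]

    on the product group, all of whose values are 1 or -1, equals 1.  Such a
    set is a Paley-Hadamard difference set as soon as [a] sums to -1 and has
    autocorrelation -1 away from the identity ([paley_hadamard_of_sign]).

    Correlation is bilinear and multiplicative on tensors, so the
    autocorrelation of [a] is a sum of sixteen explicit products.  The cross
    terms between [X (x) Y] and [J (x) d] or [d (x) J] vanish because [X] and
    [Y] have sum zero.  Those between [X (x) Y] and [d (x) d] are
    [X (x) Y] and its reflection, which cancel because [X] is even and [Y] is
    odd: this is where the skewness on one side and the symmetry on the other
    are combined.  In what remains, the coefficients of [J (x) d] and [d (x) J] are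
    v + 2 eps - v' and its opposite, and these vanish because v' = v + delta. *)

Set Implicit Arguments.
Unset Strict Implicit.
Unset Printing Implicit Defensive.

Import GRing.Theory.
Local Open Scope ring_scope.

(** * Correlation of functions on a finite group *)

(** In the group ring, this is the coefficient at [g] of [f] times the
    reflection of [k]. *)
Definition corr (gT : finGroupType) (f k : gT -> rat) (g : gT) : rat :=
  \sum_y f (g * y)%g * k y.

Definition cst (gT : finGroupType) (c : rat) : gT -> rat := fun=> c.

Definition delta1 (gT : finGroupType) (x : gT) : rat := (x == 1%g)%:R.

Definition ind (gT : finGroupType) (D : {set gT}) (x : gT) : rat :=
  (x \in D)%:R.

Definition tens (gT hT : finGroupType) (f : gT -> rat) (k : hT -> rat)
    (p : (gT * hT)%type) : rat := f p.1 * k p.2.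

Section Correlation.
Variable gT : finGroupType.
Implicit Types (f k : gT -> rat) (D : {set gT}) (x : gT).

Lemma corrDl f1 f2 k g : corr (f1 \+ f2) k g = corr f1 k g + corr f2 k g.
Proof. by rewrite /corr -big_split; apply: eq_bigr => y _; rewrite /= mulrDl. Qed.

Lemma corrDr f k1 k2 g : corr f (k1 \+ k2) g = corr f k1 g + corr f k2 g.
Proof. by rewrite /corr -big_split; apply: eq_bigr => y _; rewrite /= mulrDr. Qed.

Lemma corrZl c f k g : corr (c \*o f) k g = c * corr f k g.
Proof. by rewrite /corr big_distrr; apply: eq_bigr => y _; rewrite /= mulrA. Qed.

Lemma corrZr c f k g : corr f (c \*o k) g = c * corr f k g.
Proof. by rewrite /corr big_distrr; apply: eq_bigr => y _; rewrite /= mulrCA. Qed.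

Lemma corr_cstr f c g : corr f (cst c) g = (\sum_x f x) * c.
Proof.
rewrite /corr big_distrl [RHS](reindex_inj (mulgI g)) /=.
exact: eq_bigr.
Qed.

Lemma corr_cstl f c g : corr (cst c) f g = c * \sum_x f x.
Proof. by rewrite /corr big_distrr. Qed.

Lemma sum_cst c : \sum_(x : gT) cst c x = #|[set: gT]|%:R * c.
Proof. by rewrite sumr_const cardsT mulr_natl. Qed.

Lemma sum_mul_delta1 f : \sum_x f x * delta1 x = f 1%g.
Proof.
rewrite (bigD1 1%g) //= /delta1 eqxx mulr1 big1 ?addr0 // => x /negPf->.
by rewrite mulr0.
Qed.

Lemma sum_delta1 : \sum_(x : gT) delta1 x = 1.
Proof.
by rewrite -[RHS](sum_mul_delta1 (cst 1)); apply: eq_bigr => x _; rewrite mul1r.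
Qed.

Lemma corr_delta1r f g : corr f (@delta1 gT) g = f g.
Proof. by rewrite /corr (sum_mul_delta1 (fun y => f (g * y)%g)) mulg1. Qed.

Lemma corr_delta1l f g : corr (@delta1 gT) f g = f (g^-1)%g.
Proof.
rewrite /corr (reindex_inj (mulgI g^-1%g)) /=.
under eq_bigr => y _ do rewrite mulKVg mulrC.
by rewrite (sum_mul_delta1 (fun y => f (g^-1 * y)%g)) mulg1.
Qed.

Lemma sum_ind D : \sum_x ind D x = #|D|%:R.
Proof.
rewrite -sum1_card natr_sum [RHS]big_mkcond.
by apply: eq_bigr => x _; rewrite /ind; case: ifP.
Qed.

Lemma num_diff_corr D g : (num_diff D g)%:R = corr (ind D) (ind D) g.
Proof.
pose S := [set y | (g * y)%g \in D & y \in D].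
have -> : num_diff D g = #|S|.
  have inj : injective (fun y : gT => (g * y, y)%g) by move=> x y [].
  rewrite /num_diff -(card_imset _ inj); apply: eq_card => -[x y].
  rewrite !inE /=; apply/andP/imsetP => [[/andP[xD yD] /eqP gE]|].
    have gyE : (g * y)%g = x by rewrite -gE mulgKV.
    by exists y; rewrite ?inE gyE ?xD.
  case=> z; rewrite inE => /andP[gzD zD] [-> ->].
  by rewrite gzD zD mulgK.
rewrite -sum_ind; apply: eq_bigr => y _.
by rewrite /ind inE -natrM mulnb.
Qed.

Lemma num_diff1 D : (num_diff D 1)%:R = #|D|%:R :> rat.
Proof.
rewrite num_diff_corr -sum_ind /corr.
by apply: eq_bigr => y _; rewrite mul1g /ind -natrM mulnb andbb.
Qed.

(** * Difference sets and sign functions *)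

(** The indicator of the set is [(1 + a) / 2]; expanding its autocorrelation
    turns the two hypotheses on [a] into the size and the multiplicity. *)
Lemma paley_hadamard_of_sign (a : gT -> rat) :
    (forall x, a x = 1 \/ a x = -1) ->
    \sum_x a x = -1 ->
    (forall g, g != 1%g -> corr a a g = -1) ->
  paley_hadamard #|[set: gT]|%:R [set x | a x == 1].
Proof.
move=> a_sign a_sum a_corr; set E := [set x | _].
have indE : ind E =1 (2^-1 \*o (cst 1 \+ a)).
  move=> x; rewrite /ind inE /= /cst.
  case: (a_sign x) => ->; rewrite ?eqxx ?mulr1n; first by field.
  by rewrite subrr mulr0.
split=> [//||g g1].
  rewrite -sum_ind (eq_bigr _ (fun x _ => indE x)) /= -big_distrr big_split /=.
  by rewrite sum_cst a_sum; field.
have -> : (num_diff E g)%:R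
    = corr (2^-1 \*o (cst 1 \+ a)) (2^-1 \*o (cst 1 \+ a)) g.
  by rewrite num_diff_corr; apply: eq_bigr => y _; rewrite !indE.
rewrite corrZl corrZr !corrDl !corrDr !corr_cstl corr_cstr sum_cst a_sum.
by rewrite a_corr //; field.
Qed.

(** * The character of a Paley-type set *)

(** For the nonzero squares of a finite field this is the quadratic character.
    The linear form in indicators, rather than a case distinction, lets
    bilinearity of [corr] compute its autocorrelation. *)
Definition character D : gT -> rat :=
  2 \*o ind D \+ (cst (-1) \+ @delta1 gT).

Lemma character1 D : 1%g \notin D -> character D 1%g = 0.
Proof.
rewrite /character /= /ind /delta1 /cst eqxx => /negPf->.
by rewrite mulr1n mulr0n; ring.
Qed.

Lemma character_neq1 D x :
  x != 1%g -> character D x = if x \in D then 1 else -1.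
Proof.
rewrite /character /= /ind /delta1 /cst => /negPf->; rewrite mulr0n.
by case: ifP => _; rewrite ?mulr1n ?mulr0n; ring.
Qed.

Lemma sum_character D (v : rat) :
    #|[set: gT]|%:R = v -> #|D|%:R = (v - 1) / 2 ->
  \sum_x character D x = 0.
Proof.
move=> vE kE; rewrite /character /= !big_split -big_distrr /=.
by rewrite sum_ind sum_delta1 sum_cst vE kE; field.
Qed.

(** The multiplicity of [g] that the hypothesis prescribes is [(v - 1) / 4]
    when neither [g] nor its inverse is in [D], [(v - 3) / 4] when one is, and
    [(v - 5) / 4] when both are, which covers the symmetric and the skew case
    at once. *)
Lemma corr_character D (v : rat) :
    #|[set: gT]|%:R = v -> #|D|%:R = (v - 1) / 2 -> 1%g \notin D ->
    (forall g, g != 1%g ->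
      (num_diff D g)%:R = (v - 1 - 2 * (ind D g + ind D g^-1%g)) / 4) ->
  forall g, corr (character D) (character D) g = v * delta1 g - 1.
Proof.
move=> vE kE D1 multD g.
rewrite /character !corrDl !corrDr !corrZl !corrZr.
rewrite !corr_cstl !corr_cstr !corr_delta1r corr_delta1l -num_diff_corr.
rewrite sum_ind sum_delta1 sum_cst vE kE /cst.
have [->|g1] := eqVneq g 1%g.
  rewrite num_diff1 kE /ind /delta1 invg1 eqxx (negPf D1) mulr1n mulr0n.
  by field.
by rewrite multD // /delta1 (negPf g1) mulr0n; field.
Qed.

Lemma skew_memV D x : Defs.skew D -> x != 1%g -> (x^-1%g \in D) = (x \notin D).
Proof.
case=> cover _ _ disj x1.
have := in_setT x; rewrite cover !inE (negPf x1) /=.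
case: (boolP (x \in D)) => [xD _ | _ //].
by apply/negbTE; have := disjointFr disj xD; rewrite inE => ->.
Qed.

Lemma character_even D x :
  regular_set D -> character D x^-1%g = character D x.
Proof.
case=> _ Dinv; rewrite /character /= /ind /delta1 /cst invg_eq1.
by rewrite -mem_invg -Dinv.
Qed.

Lemma character_odd D x :
  Defs.skew D -> character D x^-1%g = - character D x.
Proof.
move=> skD; have D1 : 1%g \notin D.
  by case: skD => _ disj _ _; rewrite -disjoints1.
have [->|x1] := eqVneq x 1%g; first by rewrite invg1 character1 ?oppr0.
rewrite !character_neq1 ?invg_eq1 // skew_memV //.
by case: (x \in D); rewrite ?opprK.
Qed.

End Correlation.

(** * Tensors on a product group *)

Section Tensors.
Variables gT hT : finGroupType.
Implicit Types (f : gT -> rat) (k : hT -> rat).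

Lemma sum_tens f k : \sum_p tens f k p = (\sum_x f x) * \sum_y k y.
Proof. by rewrite big_distrlr pair_bigA. Qed.

Lemma corr_tens f1 f2 k1 k2 p :
  corr (tens f1 k1) (tens f2 k2) p = corr f1 f2 p.1 * corr k1 k2 p.2.
Proof.
rewrite /corr big_distrlr pair_bigA; apply: eq_bigr => q _.
by rewrite /tens /= mulrACA.
Qed.

(** The constants are put inside the tensor factors so that everything is a
    sum of pure tensors. *)
Definition twin_sign (eps : rat) (X : gT -> rat) (Y : hT -> rat) :=
  tens X Y \+ (tens (cst eps) (@delta1 hT) \+
    (tens (@delta1 gT) (cst (- eps)) \+ tens (@delta1 gT) (@delta1 hT))).

Lemma sum_twin_sign (eps v v' : rat) X Y :
    #|[set: gT]|%:R = v -> #|[set: hT]|%:R = v' ->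
    eps ^+ 2 = 1 -> v' = v + 2 * eps -> \sum_x X x = 0 ->
  \sum_p twin_sign eps X Y p = -1.
Proof.
move=> vE v'E eps2 v'v X0; rewrite /twin_sign !big_split /= !sum_tens.
rewrite X0 !sum_cst !sum_delta1 vE v'E v'v; ring: eps2.
Qed.

Lemma corr_twin_sign (eps v v' : rat) X Y :
    #|[set: gT]|%:R = v -> #|[set: hT]|%:R = v' ->
    eps ^+ 2 = 1 -> v' = v + 2 * eps ->
    \sum_x X x = 0 -> \sum_y Y y = 0 ->
    (forall x, X x^-1%g = X x) -> (forall y, Y y^-1%g = - Y y) ->
    (forall x, corr X X x = v * delta1 x - 1) ->
    (forall y, corr Y Y y = v' * delta1 y - 1) ->
  forall p, p != 1%g -> corr (twin_sign eps X Y) (twin_sign eps X Y) p = -1.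
Proof.
move=> vE v'E eps2 v'v X0 Y0 Xeven Yodd XX YY [x y] p1.
(* The only place where the point is not the identity matters: the remaining
   multiple of the indicator of the identity vanishes there. *)
have dd : delta1 x * delta1 y = 0.
  rewrite /delta1 -natrM mulnb; case: eqP => //= xE; case: eqP => //= yE.
  by rewrite xE yE eqxx in p1.
rewrite /twin_sign !corrDl !corrDr !corr_tens /= XX YY.
rewrite !corr_cstl !corr_cstr !corr_delta1r !corr_delta1l Xeven Yodd.
rewrite X0 Y0 !sum_cst !sum_delta1 vE v'E v'v /cst.
ring: eps2 dd.
Qed.

Lemma twin_sign_pm1 (eps : rat) (D : {set gT}) (D' : {set hT}) p :
    eps = 1 \/ eps = -1 -> 1%g \notin D -> 1%g \notin D' ->
  twin_sign eps (character D) (character D') p = 1 \/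
  twin_sign eps (character D) (character D') p = -1.
Proof.
case: p => x y epsE D1 D'1; rewrite /twin_sign /tens /= /delta1 /cst.
have [->|x1] := eqVneq x 1%g; have [->|y1] := eqVneq y 1%g;
  rewrite ?(character1 D1) ?(character1 D'1) ?character_neq1 ?mulr1n ?mulr0n //.
- by case: epsE => ->; left; ring.
- by case: epsE => ->; [right | left]; ring.
- by case: epsE => ->; [left | right]; ring.
- by case: (x \in D); case: (y \in D');
    [left | right | right | left]; ring.
Qed.

End Tensors.

Theorem theorem5p3 (v delta : rat) (hdelta : delta = 2 \/ delta = - 2)
    (G G' : finGroupType)
    (hG : exists D : {set G}, paley_type_pds v D)
    (hG' : exists D' : {set G'}, skew_hadamard (v + delta) D') :
  exists E : {set (G * G')%type}, paley_hadamard (v * (v + delta)) E.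
Proof.
case: hG => D [vE kE multin multout regD].
case: hG' => D' [[v'E k'E mult'] skD'].
have D1 : 1%g \notin D by case: regD.
have D'1 : 1%g \notin D' by case: skD' => _ disj _ _; rewrite -disjoints1.
pose eps := delta / 2.
have epsE : eps = 1 \/ eps = -1.
  by rewrite /eps; case: hdelta => ->; [left | right]; field.
have eps2 : eps ^+ 2 = 1 by case: epsE => ->; ring.
have v'v : v + delta = v + 2 * eps by rewrite /eps; field.
have XX := corr_character vE kE D1; have YY := corr_character v'E k'E D'1.
have wE : v * (v + delta) = #|[set: (G * G')%type]|%:R.
  by rewrite -v'E -vE -natrM !cardsT card_prod.
rewrite wE.
eexists; apply: (@paley_hadamard_of_sign _
  (twin_sign eps (character D) (character D'))).
- by move=> p; apply: twin_sign_pm1.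
- exact: (sum_twin_sign _ vE v'E eps2 v'v (sum_character vE kE)).
- apply: (corr_twin_sign vE v'E eps2 v'v (sum_character vE kE)
    (sum_character v'E k'E)) => [x|y||].
  + exact: character_even.
  + exact: character_odd.
  + apply: XX => g g1; have gV : (g^-1%g \in D) = (g \in D).
      by case: regD => _ Dinv; rewrite -mem_invg -Dinv.
    rewrite /ind gV; case: (boolP (g \in D)) => gD.
      by rewrite multin // mulr1n; field.
    by rewrite multout // mulr0n; field.
  + apply: YY => g g1; rewrite (mult' _ g1) /ind (skew_memV skD' g1).
    by case: (g \in D'); rewrite mulr1n mulr0n; field.
Qed.
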